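(* Let $H$ be a Hilbert space. For every $0\le\alpha<1$ and for every bounded $\alpha$-paraconvex subset $P\subset H$, the set $Retr(P)$ of all continuous retractions of $H$ onto $P$ is an $\frac{\alpha(1+\alpha^2)}{1-\alpha^2}$-paraconvex subset of $C_b(H,H)$.
   Context: For a number $\alpha\ge 0$, a nonempty closed subset $P$ of a normed space $Y$ is called $\alpha$-paraconvex if for every $r>0$, every open ball $D_r\subset Y$ of radius $r$ and every $q\in \mathrm{conv}(P\cap D_r)$ one has $\mathrm{dist}(q,P)\le \alpha\cdot r$. $C_b(H,H)$ is the Banach space of all continuous bounded mappings of $H$ into itself, with the sup norm. A continuous retraction of $H$ onto $A\subset H$ is a continuous map $R:H\to H$ with $R(H)\subset A$ and $R(a)=a$ for all $a\in A$; $Retr(A)$ denotes the set of all of them. *)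

(* Defs.v *)
From HB Require Import structures.
From mathcomp Require Import all_boot all_order all_algebra.
From mathcomp Require Import all_classical all_reals all_analysis.

Set Implicit Arguments.
Unset Strict Implicit.
Unset Printing Implicit Defensive.

Import Order.TTheory GRing.Theory Num.Theory.
Import numFieldNormedType.Exports.

Local Open Scope classical_set_scope.
Local Open Scope ring_scope.

Section paraconvexity.
Context {R : realType} {Y : normedModType R}.

Definition conv_hull (A : set Y) : set Y := smallest (@convex_set R Y) A.

(* As [inf set0 = 0], this is meaningful for nonempty [A] only. *)
Definition dist (q : Y) (A : set Y) : R := inf [set `|q - a| | a in A].

Definition paraconvex (alpha : R) (P : set Y) : Prop :=
  [/\ P !=set0, closed P &
      forall r : R, 0 < r -> forall c q : Y,
        conv_hull (P `&` ball c r) q -> dist q P <= alpha * r].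

End paraconvexity.

(* The normed space of continuous bounded maps with the sup norm. *)
Section bounded_continuous.
Context {R : realType} (T : topologicalType) (V : normedModType R).

Definition bcont : {pred T -> V} :=
  mem [set f : T -> V | continuous f /\ bounded_fun f].

Record Cb := MkCb { Cb_fun :> T -> V; Cb_prop : Cb_fun \in bcont }.

HB.instance Definition _ := [isSub for Cb_fun].
HB.instance Definition _ := [Choice of Cb by <:].

Lemma bcontP (f : T -> V) : f \in bcont <->
  continuous f /\ exists M : R, forall x, `|f x| <= M.
Proof.
rewrite inE /=; split=> -[cf bf]; split=> //.
  have [M _ fM] := pinfty_ex_gt0 bf.
  by exists M => x; exact: fM.
case: bf => M fM; exists M; split; first exact: num_real.
by move=> N MN x _ /=; exact: le_trans (fM x) (ltW MN).
Qed.

Let bcont_submod : subsemimod_closed bcont.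
Proof.
split; [split|].
- apply/bcontP; split; first exact: cst_continuous.
  by exists 0 => x; rewrite normr0.
- move=> f g /bcontP[cf [M fM]] /bcontP[cg [N gN]]; apply/bcontP; split.
    by move=> x; apply: cvgD; [exact: cf|exact: cg].
  by exists (M + N) => x; rewrite (le_trans (ler_normD _ _))// lerD.
- move=> a f /bcontP[cf [M fM]]; apply/bcontP; split.
    by move=> x; apply: cvgZl_tmp; exact: cf.
  by exists (`|a| * M) => x; rewrite normrZ ler_wpM2l.
Qed.

HB.instance Definition _ := GRing.isSubmodClosed.Build R (T -> V) bcont
  bcont_submod.
HB.instance Definition _ := [SubChoice_isSubLmodule of Cb by <:].

Definition Cb_norm (f : Cb) : R := sup (range (fun x => `|f x|)).

Lemma Cb_le_norm (f : Cb) x : `|f x| <= Cb_norm f.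
Proof.
have /bcontP[_ [M fM]] := Cb_prop f.
by apply: ub_le_sup; [exists M => _ [y _ <-]|exists x].
Qed.

Lemma Cb_norm_le (f : Cb) (M : R) :
  0 <= M -> (forall x, `|f x| <= M) -> Cb_norm f <= M.
Proof.
move=> M0 fM; rewrite /Cb_norm.
have [->|/set0P ne] := eqVneq (range (fun x => `|f x|)) set0.
  by rewrite sup0.
by apply: ge_sup => // _ [x _ <-].
Qed.

Lemma Cb_norm_ge0 (f : Cb) : 0 <= Cb_norm f.
Proof.
rewrite /Cb_norm.
have [->|/set0P[_ [x _ _]]] := eqVneq (range (fun x => `|f x|)) set0.
  by rewrite sup0.
exact: le_trans (normr_ge0 _) (Cb_le_norm f x).
Qed.

Let Cb_ler_normD (f g : Cb) : Cb_norm (f + g) <= Cb_norm f + Cb_norm g.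
Proof.
apply: Cb_norm_le => [|x]; first by rewrite addr_ge0 ?Cb_norm_ge0.
by rewrite (le_trans (ler_normD _ _))// lerD// Cb_le_norm.
Qed.

Let Cb_normrZ_le (a : R) (f : Cb) : Cb_norm (a *: f) <= `|a| * Cb_norm f.
Proof.
apply: Cb_norm_le => [|x]; first by rewrite mulr_ge0 ?Cb_norm_ge0.
by rewrite normrZ ler_wpM2l// Cb_le_norm.
Qed.

Let Cb_normrZ (a : R) (f : Cb) : Cb_norm (a *: f) = `|a| * Cb_norm f.
Proof.
apply/eqP; rewrite eq_le Cb_normrZ_le/=.
have [->|a0] := eqVneq a 0; first by rewrite normr0 mul0r Cb_norm_ge0.
have := Cb_normrZ_le a^-1 (a *: f).
by rewrite scalerA mulVf// scale1r normfV mulrC ler_pdivlMr ?normr_gt0// mulrC.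
Qed.

Let Cb_normr0_eq0 (f : Cb) : Cb_norm f = 0 -> f = 0.
Proof.
move=> f0; apply/val_inj/funext => x; apply/eqP.
by rewrite -normr_le0 -f0 Cb_le_norm.
Qed.

HB.instance Definition _ := @Lmodule_isNormed.Build R Cb
  Cb_norm Cb_ler_normD Cb_normrZ Cb_normr0_eq0.

End bounded_continuous.

Definition retraction {T : topologicalType} (A : set T) (f : T -> T) : Prop :=
  [/\ continuous f, range f `<=` A & forall a, A a -> f a = a].

Section retractions.
Context {R : realType} {H : normedModType R}.

(* For bounded [A] the boundedness built into [Cb] excludes no retraction,
   see [retraction_Retr]. *)
Definition Retr (A : set H) : set (Cb H H) := [set f | retraction A f].

Lemma retraction_Retr (A : set H) (f : H -> H) :
  bounded_set A -> retraction A f ->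
  exists2 F : Cb H H, Retr A F & F = f :> (H -> H).
Proof.
move=> bA rf; have [cf fA _] := rf.
have fP : f \in @bcont R H H.
  apply/bcontP; split=> //; have [M _ AM] := pinfty_ex_gt0 bA.
  by exists M => x; apply/AM/fA; exists x.
by exists (MkCb fP).
Qed.

End retractions.

(* Main.v *)
(* It suffices to find, for each [K > (1 + alpha ^ 2) / (1 - alpha ^ 2)], a
   retraction [T] of [H] onto [P] with [|T y - y| <= K dist(y, P)]: if [q] is in
   the convex hull of the retractions in a ball of radius [r], then
   [dist(q x, P) <= alpha r] for all [x], and [T o q] is a retraction within
   [K alpha r] of [q].
     [T] is a limit of maps [f_n], starting with [f_0 = id], such that
   [P] meets the ball of radius [delta_n] about [f_n], [|f_{n+1} - f_n| < delta_n]
   and [delta_{n+1} = lambda delta_n] for some [lambda > 2 alpha^2 / (1 + alpha^2)].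
   To get [f_{n+1}], intersect [P] with [ball f_n delta_n], and refine repeatedly:
   if this intersection meets [ball g (s delta_n)] everywhere, let [h] be a
   continuous selection of the convex hull of the points of [P] in both balls.
   Where [h] is at distance at most [(1 - alpha s) delta_n] from [f_n], the points
   of [P] within [alpha s delta_n] of [h] lie in [ball f_n delta_n]; elsewhere, by
   Pythagoras, [h] is close to one of the points it is a combination of. So [s]
   can be brought down to about [2 alpha / (1 + alpha^2)], and one last use of
   paraconvexity gains another factor [alpha]. *)

Require Import Defs.
From mathcomp Require Import all_boot all_order all_algebra.
From mathcomp Require Import all_classical all_reals all_analysis.
From mathcomp Require Import wochoice ring lra.
Set Implicit Arguments.
Unset Strict Implicit.
Unset Printing Implicit Defensive.

Import Order.TTheory GRing.Theory Num.Theory.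
Import numFieldNormedType.Exports.
Local Open Scope classical_set_scope.
Local Open Scope ring_scope.

Lemma convex_setP (R : realType) (Y : normedModType R) (A : set Y) :
  @convex_set R Y A <->
  (forall x y (t : R), 0 <= t <= 1 -> A x -> A y -> A (t *: x + (1 - t) *: y)).
Proof.
split=> [cA x y t /andP[t0 t1] Ax Ay|cA x y l].
  by have := cA x y (Itv01 t0 t1); rewrite !inE; apply.
by rewrite !inE => Ax Ay; apply: (cA x y l%:num) => //; rewrite ge0 le1.
Qed.

Lemma conv_hull_convex (R : realType) (Y : normedModType R) (A : set Y) x y
    (t : R) : 0 <= t <= 1 ->
  conv_hull A x -> conv_hull A y -> conv_hull A (t *: x + (1 - t) *: y).
Proof.
move=> t01 Ax Ay C [cC AC]; have /convex_setP := cC; apply=> //.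
  by apply: Ax.
by apply: Ay.
Qed.

Lemma conv_hull_sub (R : realType) (Y : normedModType R) (A C : set Y) :
  (forall x y (t : R), 0 <= t <= 1 -> C x -> C y -> C (t *: x + (1 - t) *: y)) ->
  A `<=` C -> conv_hull A `<=` C.
Proof. by move=> /convex_setP cC AC; apply: smallest_sub. Qed.

Lemma conv_hull_mono (R : realType) (Y : normedModType R) (A B : set Y) :
  A `<=` B -> conv_hull A `<=` conv_hull B.
Proof.
move=> AB; apply: conv_hull_sub => [x y t|x Ax]; first exact: conv_hull_convex.
by move=> C [_]; apply; apply: AB.
Qed.

Lemma dist_le (R : realType) (Y : normedModType R) (A : set Y) q a :
  A a -> dist q A <= `|q - a|.
Proof. by move=> Aa; apply: ge_inf; [exists 0 => _ [b _ <-]|exists a]. Qed.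

Lemma dist_ge (R : realType) (Y : normedModType R) (A : set Y) q (d : R) :
  A !=set0 -> (forall a, A a -> d <= `|q - a|) -> d <= dist q A.
Proof.
move=> [a Aa] dA; apply: lb_le_inf; first by exists `|q - a|, a.
by move=> _ [b Ab <-]; apply: dA.
Qed.

Lemma dist_lt (R : realType) (Y : normedModType R) (A : set Y) q (d : R) :
  A !=set0 -> dist q A < d -> exists2 a, A a & `|q - a| < d.
Proof.
move=> A0 dA; apply: contrapT => h; move: dA; rewrite ltNge => /negP; apply.
apply: dist_ge => // a Aa; rewrite leNgt; apply/negP => qa; apply: h.
by exists a.
Qed.

Lemma dist_lipschitz (R : realType) (Y : normedModType R) (A : set Y) x y :
  A !=set0 -> dist x A <= `|x - y| + dist y A.
Proof.
move=> A0; rewrite -lerBlDl; apply: dist_ge => // a Aa; rewrite lerBlDl.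
apply: le_trans (dist_le _ Aa) _.
by rewrite (le_trans _ (ler_normD _ _))// subrKA.
Qed.

Lemma dist_continuous (R : realType) (Y : normedModType R) (A : set Y) :
  A !=set0 -> continuous (fun x => dist x A).
Proof.
move=> A0 x; apply/cvgrPdist_lt => e e0; near=> y.
have xy : `|x - y| < e by near: y; apply: cvgr_dist_lt.
have := dist_lipschitz x y A0; have := dist_lipschitz y x A0.
rewrite (distrC y x) => h1 h2; rewrite (le_lt_trans _ xy)// ler_norml.
by apply/andP; split; lra.
Unshelve. all: by end_near. Qed.

Lemma dist_gt0 (R : realType) (Y : normedModType R) (A : set Y) x :
  A !=set0 -> closed A -> ~ A x -> 0 < dist x A.
Proof.
move=> A0 cA nAx.
have /nbhs_ballP[e /= e0 xe] : nbhs x (~` A).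
  by apply: open_nbhs_nbhs; split=> //; rewrite openC.
apply: lt_le_trans e0 _; apply: dist_ge => // a Aa; rewrite leNgt; apply/negP => h.
by apply: (xe a) => //; rewrite -ball_normE.
Qed.

Lemma continuous_near_eq (T U : topologicalType) (f g : T -> U) x :
  (\forall y \near x, f y = g y) -> {for x, continuous f} ->
  {for x, continuous g}.
Proof.
move=> fg cf; change (g @ x --> g x); rewrite -(nbhs_singleton fg).
by apply: cvg_trans cf; apply: near_eq_cvg.
Qed.

Lemma plateau_function (R : realType) (X : normedModType R) (S : set X) (r : R) : 0 < r ->
  exists W : X -> R, [/\ continuous W, forall x, 0 <= W x <= 1,
    forall x s, S s -> `|x - s| < r -> W x = 1 &
    forall x, (forall s, S s -> 2 * r <= `|x - s|) -> W x = 0].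
Proof.
move=> r0; have [->|/set0P S0] := eqVneq S set0.
  by exists (fun=> 0); split=> // x; [apply: cst_continuous|rewrite lexx ler01].
pose W x := Num.min (Num.max (2 - dist x S / r) 0) 1.
exists W; split.
- apply: min_fun_continuous; last by move=> ?; apply: cst_continuous.
  apply: max_fun_continuous; last by move=> ?; apply: cst_continuous.
  move=> x; apply: cvgB; first exact: cvg_cst.
  by apply: cvgMl; apply: dist_continuous.
- by move=> x; rewrite /W le_min ler01 ge_min lexx orbT le_max lexx orbT.
- move=> x s Ss xs; rewrite /W; have h : dist x S / r <= 1.
    by rewrite ler_pdivrMr// mul1r ltW// (le_lt_trans (dist_le _ Ss)).
  by apply/min_idPr; rewrite le_max; apply/orP; left; lra.
- move=> x xS; rewrite /W; have h : 2 <= dist x S / r.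
    by rewrite ler_pdivlMr//; apply: dist_ge.
  by rewrite (max_idPr _) ?(min_idPl _) ?ler01//; lra.
Qed.

Lemma coherent_choice (T : choiceType) (x0 : T) : exists mu : set T -> T,
  (forall A, A !=set0 -> A (mu A)) /\
  forall A B, A (mu B) -> B (mu A) -> mu A = mu B.
Proof.
have [r wo] := well_ordering_principle T.
have /choice[mu muP] (A : set T) : exists z, A !=set0 ->
    A z /\ forall x, A x -> r z x.
  have [->|/set0P A0] := eqVneq A set0.
    by exists x0 => -[].
  have [|z [[]]] := wo (fun x => `[< A x >]).
    by have [x Ax] := A0; exists x; apply/asboolP.
  rewrite unfold_in => /asboolP Az zl _; exists z => _; split=> // x Ax.
  by apply: zl; rewrite unfold_in; apply/asboolP.
exists mu; split=> [A /muP[]//|A B AB BA].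
have [Am Al] := muP A (ex_intro _ _ AB); have [Bm Bl] := muP B (ex_intro _ _ BA).
have rr x : r x x.
  have [|z [[]]] := wo (pred1 x); first by exists x; rewrite inE.
  by rewrite !inE => /eqP -> zl _; apply: zl; rewrite inE.
have [|z [_ zu]] := wo (pred2 (mu A) (mu B)); first by exists (mu A); rewrite !inE eqxx.
transitivity z; [symmetry|]; apply: zu; split; rewrite ?inE ?eqxx ?orbT//.
  by move=> x /[!inE] /orP[]/eqP->//; apply: Al.
by move=> x /[!inE] /orP[]/eqP->//; apply: Bl.
Qed.

Lemma separated_layer (R : realType) (X V : normedModType R)
    (Phi : X -> set V) (mu : set V -> V) (e : R) :
  (forall A B, A (mu B) -> B (mu A) -> mu A = mu B) -> 0 < e ->
  exists (W : X -> R) (p : X -> V),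
    [/\ continuous W, continuous (fun x => W x *: p x),
        forall x, 0 <= W x <= 1, forall x, W x != 0 -> Phi x (p x) &
        forall x, (forall y, `|x - y| < e -> Phi y (mu (Phi x))) ->
          \forall y \near x, W y = 1].
Proof.
move=> muP e0; pose S := [set s | forall y, `|s - y| < e -> Phi y (mu (Phi s))].
have Smu s t : S s -> S t -> `|s - t| < e -> mu (Phi s) = mu (Phi t).
  by move=> Ss St st; apply: muP; [apply: St; rewrite distrC|apply: Ss].
pose r := e / 8; have r0 : 0 < r by rewrite divr_gt0.
have [W [cW W01 W1 W0]] := plateau_function S r0.
have /choice[p pP] (x : X) : exists p, forall s, S s -> `|x - s| < 3 * r ->
    p = mu (Phi s).
  have [[s Ss xs]|ns] := pselect (exists2 s, S s & `|x - s| < 3 * r).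
    exists (mu (Phi s)) => t St xt; apply: Smu => //.
    apply: le_lt_trans (ler_distD x _ _) _; rewrite (distrC s).
    by rewrite /r in xs xt; lra.
  by exists 0 => s Ss xs; case: ns; exists s.
have xS x : W x != 0 -> exists2 s, S s & `|x - s| < 2 * r.
  move=> /eqP Wx; apply: contrapT => h; apply/Wx/W0 => s Ss; rewrite leNgt.
  by apply/negP => xs; apply: h; exists s.
exists W, p; split=> // [x|x Wx|x Sx]; last 2 first.
- have [s Ss xs] := xS _ Wx; rewrite (pP x s)//; last by rewrite (lt_trans xs)//; lra.
  by apply: Ss; rewrite distrC (lt_trans xs)// /r; lra.
- near=> y; have xy : `|x - y| < r by near: y; apply: cvgr_dist_lt.
  by apply: (W1 y x) => //; rewrite distrC.
have [[s Ss xs]|ns] := pselect (exists2 s, S s & `|x - s| < 3 * r).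
  apply: (@continuous_near_eq _ _ (fun y => W y *: p x)).
    near=> y; congr (_ *: _); rewrite (pP x s)//; apply/esym/pP => //.
    have xy : `|x - y| < 3 * r - `|x - s|.
      by near: y; apply: cvgr_dist_lt => //; rewrite subr_gt0.
    by apply: le_lt_trans (ler_distD x _ _) _; rewrite (distrC y); lra.
  by apply: cvgZr_tmp; apply: cW.
apply: (@continuous_near_eq _ _ (fun=> 0)); last exact: cst_continuous.
near=> y; have [->|/xS[s Ss ys]] := eqVneq (W y) 0; first by rewrite scale0r.
have xy : `|x - y| < r by near: y; apply: cvgr_dist_lt.
case: ns; exists s => //.
by apply: le_lt_trans (ler_distD y _ _) _; lra.
Unshelve. all: by end_near. Qed.

(* A partition of unity built from the layers [W n], written as the telescoping
   sum of [W n * prod_(k < n) (1 - W k)]: near a point of the domain some [W n]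
   is identically [1], so that only finitely many terms survive there. *)
Lemma glue_layers (R : realType) (X V : normedModType R) (Phi : X -> set V)
    (W : nat -> X -> R) (p : nat -> X -> V) :
  (forall n, continuous (W n)) ->
  (forall n, continuous (fun x => W n x *: p n x)) ->
  (forall n x, 0 <= W n x <= 1) ->
  (forall n x, W n x != 0 -> Phi x (p n x)) ->
  exists g : X -> V, forall x n, (\forall y \near x, W n y = 1) ->
    {for x, continuous g} /\ conv_hull (Phi x) (g x).
Proof.
move=> cW cp W01 Wp.
pose rest n x := \prod_(k < n) (1 - W k x).
pose a n x := \sum_(k < n) rest k x *: (W k x *: p k x).
have restS n x : rest n.+1 x = rest n x * (1 - W n x) by rewrite /rest big_ord_recr.
have aS n x : a n.+1 x = a n x + rest n x *: (W n x *: p n x).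
  by rewrite /a big_ord_recr.
have rest0 m n x : (m <= n)%N -> rest m x = 0 -> rest n x = 0 /\ a n x = a m x.
  move=> /subnK <-; elim: (n - m)%N => // k IH /IH[h1 h2].
  by rewrite addSn restS aS h1 mul0r scale0r addr0.
pose N x := xget 0%N [set n | rest n x = 0].
pose g x := a (N x) x.
have gE n x : rest n x = 0 -> g x = a n x.
  move=> rn; have rN : rest (N x) x = 0.
    by apply: (@xgetPex _ 0%N [set n | rest n x = 0]); exists n.
  rewrite /g; have [/rest0|/ltnW/rest0] := leqP n (N x); first by case/(_ _ rn).
  by case/(_ _ rN) => _ ->.
have cr n : continuous (rest n).
  elim: n => [|n IH] x.
    apply: (@continuous_near_eq _ _ (fun=> 1 : R)); last exact: cst_continuous.
    by near=> y; rewrite /rest big_ord0.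
  apply: (@continuous_near_eq _ _ (fun y => rest n y * (1 - W n y))).
    by near=> y; rewrite restS.
  apply: cvgM; first exact: IH.
  by apply: cvgB; [exact: cvg_cst|exact: cW].
have ca n : continuous (a n).
  elim: n => [|n IH] x.
    apply: (@continuous_near_eq _ _ (fun=> 0 : V)); last exact: cst_continuous.
    by near=> y; rewrite /a big_ord0.
  apply: (@continuous_near_eq _ _ (fun y => a n y + rest n y *: (W n y *: p n y))).
    by near=> y; rewrite aS.
  apply: cvgD; first exact: IH.
  by apply: cvgZ; [exact: cr|exact: cp].
have hull n x z : conv_hull (Phi x) z -> conv_hull (Phi x) (a n x + rest n x *: z).
  elim: n z => [|n IH] z hz; first by rewrite /a /rest !big_ord0 add0r scale1r.
  rewrite aS restS -addrA -scalerA -scalerDr; apply: IH.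
  have [->|/Wp Wx] := eqVneq (W n x) 0; first by rewrite scale0r add0r subr0 scale1r.
  by apply: conv_hull_convex => // C [_]; apply.
exists g => x n W1.
have r1 : \forall y \near x, rest n.+1 y = 0.
  by near=> y; rewrite restS (near W1 y)// subrr mulr0.
split.
  apply: (@continuous_near_eq _ _ (a n.+1)); last exact: ca.
  by near=> y; rewrite (gE n.+1)//; near: y.
have Wx1 := nbhs_singleton W1; have rx := nbhs_singleton r1.
have /(hull n.+1) : conv_hull (Phi x) (p n x).
  by move=> C [_]; apply; apply: Wp; rewrite Wx1 oner_eq0.
by rewrite rx scale0r addr0 -gE.
Unshelve. all: by end_near. Qed.

(* Browder's selection theorem on a metric domain. The paracompactness it needs
   comes from the layers [{x | ball x (n+1)^-1 <= {y | Phi y p}}] with [p] coherently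
   chosen: those of different [p] are [(n+1)^-1]-separated. *)
Lemma browder_selection (R : realType) (X V : normedModType R)
    (Phi : X -> set V) :
  (forall p, open [set x | Phi x p]) ->
  exists g : X -> V, forall x, Phi x !=set0 ->
    {for x, continuous g} /\ conv_hull (Phi x) (g x).
Proof.
move=> oPhi; have [mu [muA muP]] := coherent_choice (0 : V).
have e0 n : 0 < n.+1%:R^-1 :> R by rewrite invr_gt0.
have /choice[W /choice[p Wp]] n := separated_layer Phi muP (e0 n).
have [||||g gP] := @glue_layers _ _ _ Phi W p; try by move=> n; have [] := Wp n.
exists g => x /muA xmu.
have /nbhs_ballP[e /= e_gt0 xe] : nbhs x [set y | Phi y (mu (Phi x))].
  by apply: open_nbhs_nbhs.
have [n _ /(_ n (leqnn n)) ne] := near_infty_natSinv_lt (PosNum e_gt0).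
apply: (gP x n); have [_ _ _ _] := Wp n; apply=> y xy; apply: xe.
by rewrite -ball_normE /=; apply: lt_trans ne.
Qed.

Lemma near_dist_lt (R : realType) (X V : normedModType R) (f : X -> V)
    (d : X -> R) p x : {for x, continuous f} -> {for x, continuous d} ->
  `|p - f x| < d x -> \forall y \near x, `|p - f y| < d y.
Proof.
move=> cf cd pd; have {}cf : f y @[y --> x] --> f x := cf.
have {}cd : d y @[y --> x] --> d x := cd; pose e := (d x - `|p - f x|) / 2.
have e0 : 0 < e by rewrite divr_gt0// subr_gt0.
near=> y; have fy : `|f x - f y| < e by near: y; move/cvgrPdist_lt: cf; apply.
have : `|d x - d y| < e by near: y; move/cvgrPdist_lt: cd; apply.
rewrite ltr_norml => /andP[_ dy].
by apply: le_lt_trans (ler_distD (f x) _ _) _; rewrite /e in fy dy; lra.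
Unshelve. all: by end_near. Qed.

Lemma lt_convex (R : realType) (a b c t : R) :
  0 <= t <= 1 -> a < c -> b < c -> t * a + (1 - t) * b < c.
Proof.
move=> /andP[t0 t1] ac bc; have -> : c = t * c + (1 - t) * c by ring.
have [->|tn0] := eqVneq t 0; first by rewrite !mul0r !add0r subr0 !mul1r.
by rewrite ltr_leD ?ler_wpM2l ?ltr_pM2l ?(ltW bc) ?subr_ge0// lt_neqAle eq_sym tn0.
Qed.

(* Some [a] lies on the side of the hyperplane through [h] orthogonal to [h - f]
   that is away from [f]. *)
Lemma conv_hull_pythagoras (R : realType) (H : normedModType R)
    (inner : {dot H for idfun}) (normE : forall x : H, `|x| ^+ 2 = inner x x)
    (A : set H) (f h : H) (d : R) :
  (forall a, A a -> `|a - f| < d) -> conv_hull A h ->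
  exists2 a, A a & `|a - h| ^+ 2 < d ^+ 2 - `|h - f| ^+ 2.
Proof.
move=> Ad hA; have [a Aa ah] : exists2 a, A a & 0 <= inner (a - h) (h - f).
  apply: contrapT => nA.
  suff : [set y | inner y (h - f) < inner h (h - f)] h by rewrite /= ltxx.
  move: hA; apply: conv_hull_sub => /= [x y t t01 hx hy|a Aa].
    by rewrite linearDl !linearZl_LR/=; apply: lt_convex.
  by rewrite /= -subr_lt0 -linearBl ltNge; apply/negP => ah; apply: nA; exists a.
exists a => //; have -> : d ^+ 2 - `|h - f| ^+ 2 = d ^+ 2 - `|a - f| ^+ 2
    + `|a - h| ^+ 2 + 2 * inner (a - h) (h - f).
  have -> : a - f = (a - h) + (h - f) by rewrite subrKA.
  have sym u v : inner u v = inner v u.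
    by have := hermC inner u v; rewrite expr0 mul1r.
  move: (a - h) (h - f) => u v.
  by rewrite !normE linearDl !linearDr/= (sym v u); ring.
have := Ad _ Aa; have := normr_ge0 (a - f); nra.
Qed.

Lemma conv_hull_ball (R : realType) (H : normedModType R) (A : set H) (f h : H)
    (d : R) :
  (forall a, A a -> `|a - f| < d) -> conv_hull A h -> `|h - f| < d.
Proof.
move=> Ad; rewrite -[X in _ -> X]/([set h | `|h - f| < d] h).
apply: conv_hull_sub => //= x y t t01 xd yd.
have -> : t *: x + (1 - t) *: y - f = t *: (x - f) + (1 - t) *: (y - f).
  by rewrite !scalerBr addrACA -opprD -scalerDl [t + _]addrC subrK scale1r.
apply: le_lt_trans (ler_normD _ _) _; have /andP[t0 t1] := t01.
by rewrite !normrZ !ger0_norm ?subr_ge0//; apply: lt_convex.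
Qed.

Section refinement.
Context {R : realType} {H : normedModType R} (P O : set H) (alpha : R).
Context (f : H -> H) (delta : H -> R).
Context (alpha_ge0 : 0 <= alpha).
Context (P_paraconvex : paraconvex alpha P).
Context (O_open : open O).
Context (f_cont : forall x, O x -> {for x, continuous f}).
Context (delta_cont : forall x, O x -> {for x, continuous delta}).
Context (delta_gt0 : forall x, O x -> 0 < delta x).

Let A (g : H -> H) s x : set H :=
  [set p | [/\ P p, `|p - f x| < delta x & `|p - g x| < s * delta x]].

(* [P] comes within [s * delta] of some continuous map without leaving the ball
   of radius [delta] about [f]. *)
Definition reachable s := exists2 g : H -> H,
  (forall x, O x -> {for x, continuous g}) & forall x, O x -> A g s x !=set0.

Lemma reachable_le s t : s <= t -> reachable s -> reachable t.
Proof.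
move=> st [g cg gA]; exists g => // x Ox; have [p [Pp pf pg]] := gA x Ox.
by exists p; split=> //; apply: lt_le_trans pg _; rewrite ler_pM2r ?delta_gt0.
Qed.

Lemma reachable_hull a s : alpha < a -> 0 < s -> reachable s ->
  exists2 h : H -> H, (forall x, O x -> {for x, continuous h}) &
  forall x, O x -> [/\ `|h x - f x| < delta x,
    exists2 p, P p & `|p - h x| < a * s * delta x &
    exists g, conv_hull (A g s x) (h x)].
Proof.
move=> a_gt s0 [g cg gA]; pose Phi x := [set p | O x /\ A g s x p].
have [p|h hP] := @browder_selection _ _ _ Phi.
  rewrite openE => x /= [Ox [Pp pf pg]]; rewrite /interior /=.
  have Ox' : \forall y \near x, O y by apply: open_nbhs_nbhs.
  have pf' := near_dist_lt (f_cont Ox) (delta_cont Ox) pf.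
  have cs : {for x, continuous (fun y => s * delta y)}.
    by apply: cvgMr; apply: delta_cont.
  have pg' := near_dist_lt (cg _ Ox) cs pg.
  by near=> y; split; [|split=> //]; near: y.
have Phi0 x : O x -> Phi x !=set0 by move=> Ox; have [p] := gA x Ox; exists p.
exists h => x Ox; have [ch hx] := hP x (Phi0 x Ox); first exact: ch.
have {}hx : conv_hull (A g s x) (h x) by apply: conv_hull_mono hx => p [].
split; last by exists g.
  by apply: conv_hull_ball hx => p [].
have [P0 _ /(_ (s * delta x) _ (g x) (h x)) Pa] := P_paraconvex.
have sd0 : 0 < s * delta x by rewrite mulr_gt0 ?delta_gt0.
have : dist (h x) P < a * s * delta x.
  apply: le_lt_trans (Pa _ _) _ => //; last by rewrite -mulrA ltr_pM2r.
  apply: conv_hull_mono hx => p [Pp _ pg]; split=> //.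
  by rewrite -ball_normE /= distrC.
by move/(dist_lt P0) => [p Pp ph]; exists p => //; rewrite distrC.
Unshelve. all: by end_near. Qed.

Context (inner : {dot H for idfun}) (normE : forall x : H, `|x| ^+ 2 = inner x x).

(* Where [h x] stays away from the sphere of radius [delta x] about [f x],
   paraconvexity yields the point; near that sphere Pythagoras does. *)
Lemma reachable_improve a s t : alpha < a -> a <= 1 -> 0 < s -> s <= 1 ->
  0 <= t -> 2 * (a * s) - (a * s) ^+ 2 <= t ^+ 2 ->
  reachable s -> reachable t.
Proof.
move=> a_gt a1 s0 s1 t0; set u := a * s => ut /(reachable_hull a_gt s0)[h ch hP].
have a0 : 0 <= a by apply: le_trans alpha_ge0 (ltW a_gt).
have u0 : 0 <= u by rewrite mulr_ge0// ltW.
have u1 : u <= 1 by rewrite mulr_ile1// ltW.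
exists h => // x Ox; have dx := delta_gt0 Ox.
have [hf [p Pp ph] [g hg]] := hP x Ox.
have [hu|hu] := leP (`|h x - f x|) ((1 - u) * delta x).
  exists p; split=> //.
    by apply: le_lt_trans (ler_distD (h x) _ _) _; rewrite -/u in ph; lra.
  apply: lt_le_trans ph _; rewrite ler_pM2r// -(@ler_pXn2r _ 2) ?nnegrE//.
  apply: le_trans ut; rewrite -/u; nra.
have [q [Pq qf _] qh] : exists2 q, A g s x q &
    `|q - h x| ^+ 2 < delta x ^+ 2 - `|h x - f x| ^+ 2.
  by apply: (conv_hull_pythagoras normE _ hg) => q [].
exists q; split=> //; rewrite -(@ltr_pXn2r _ 2) ?nnegrE ?mulr_ge0// ?(ltW dx)//.
apply: lt_le_trans qh _; rewrite exprMn.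
have hu2 : ((1 - u) * delta x) ^+ 2 <= `|h x - f x| ^+ 2.
  by rewrite ler_pXn2r ?nnegrE ?mulr_ge0 ?subr_ge0 ?(ltW dx) ?(ltW hu).
rewrite exprMn in hu2; have := sqr_ge0 (delta x); nra.
Qed.

(* The recursion [t ^ 2 = 2 a s - (a s) ^ 2] of [reachable_improve] has the fixed
   point [2 a / (1 + a ^ 2)]. *)
Lemma reachable_iter a sigma : alpha < a -> a <= 1 -> 0 < sigma ->
  2 * a < sigma * (1 + a ^+ 2) -> reachable 1 -> reachable sigma.
Proof.
move=> a_gt a1 sigma0 asigma r1.
have [?|sigma1] := leP 1 sigma; first exact: reachable_le r1.
have a0 : 0 < a by apply: le_lt_trans a_gt.
pose g2 := 2 * a / sigma - a ^+ 2; pose g := Num.sqrt g2.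
have h2 : 2 <= 2 / sigma by rewrite ler_pdivlMr//; lra.
have g20 : 0 <= g2 by rewrite subr_ge0 mulrAC expr2 ler_pM2r//; lra.
have g2lt1 : g2 < 1 by rewrite ltrBlDr ltr_pdivrMr// [_ * sigma]mulrC.
have gE : g ^+ 2 = g2 by rewrite sqr_sqrtr.
have g0 : 0 <= g by rewrite sqrtr_ge0.
have g1 : g < 1 by rewrite -(@ltr_pXn2r _ 2) ?nnegrE// gE expr1n.
have rn n : reachable (Num.max (g ^+ n) sigma).
  elim: n => [|n]; first by apply: reachable_le r1; rewrite expr0 le_max lexx.
  set s := Num.max _ _ => IH.
  have ssigma : sigma <= s by rewrite le_max lexx orbT.
  have s0 : 0 < s by lra.
  have s1 : s <= 1 by rewrite ge_max (ltW sigma1) exprn_ile1// ltW.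
  have gs : g * s <= Num.max (g ^+ n.+1) sigma.
    rewrite /s le_max; have [_|_] := leP (g ^+ n) sigma; last by rewrite exprS lexx.
    by apply/orP; right; nra.
  apply: reachable_le gs _; apply: (reachable_improve a_gt) IH => //.
    by rewrite mulr_ge0// ltW.
  rewrite [(g * s) ^+ 2]exprMn gE /g2; have : s * 1 <= s * (s / sigma).
    by rewrite ler_pM2l// ler_pdivlMr// mul1r.
  have -> : (2 * a / sigma - a ^+ 2) * s ^+ 2 = 2 * a * (s * (s / sigma)) - (a * s) ^+ 2.
    by ring.
  by rewrite mulr1 => ss; rewrite lerD2r mulrA ler_pM2l// mulr_gt0.
have /cvgrPdist_lt/(_ _ sigma0)[n _ /(_ n (leqnn n))] : g ^+ n @[n --> \oo] --> 0.
  by apply: cvg_expr; rewrite ger0_norm.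
rewrite /= sub0r normrN ger0_norm ?exprn_ge0// => /ltW gn.
by have := rn n; rewrite (max_idPr gn).
Qed.
End refinement.

Lemma approximation_step (R : realType) (H : normedModType R)
    (inner : {dot H for idfun}) (normE : forall x : H, `|x| ^+ 2 = inner x x)
    (P O : set H) (alpha lambda : R) (f : H -> H) (delta : H -> R) :
  0 <= alpha -> paraconvex alpha P -> open O ->
  lambda < 1 -> 2 * alpha ^+ 2 < lambda * (1 + alpha ^+ 2) ->
  (forall x, O x -> {for x, continuous f}) ->
  (forall x, O x -> {for x, continuous delta}) ->
  (forall x, O x -> 0 < delta x) ->
  (forall x, O x -> exists2 p, P p & `|p - f x| < delta x) ->
  exists2 h : H -> H, (forall x, O x -> {for x, continuous h}) &
    forall x, O x -> `|h x - f x| < delta x /\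
      exists2 p, P p & `|p - h x| < lambda * delta x.
Proof.
move=> a0 Ppara oO l1 al cf cd d0 Pf.
have l0 : 0 < lambda by have := sqr_ge0 alpha; nra.
have [a [a_gt a1 al']] : exists a,
    [/\ alpha < a, a <= 1 & 2 * a ^+ 2 < lambda * (1 + a ^+ 2)].
  pose b := Num.sqrt (lambda / (2 - lambda)).
  have l2 : 0 < 2 - lambda by lra.
  have b0 : 0 <= b by rewrite sqrtr_ge0.
  have bE : b ^+ 2 * (2 - lambda) = lambda.
    by rewrite sqr_sqrtr ?divr_ge0 ?(ltW l0) ?(ltW l2)// divfK// gt_eqF.
  have ab : alpha < b by rewrite -(@ltr_pXn2r _ 2) ?nnegrE// -(ltr_pM2r l2) bE; lra.
  have b1 : b < 1 by rewrite -(@ltr_pXn2r _ 2) ?nnegrE// -(ltr_pM2r l2) bE; lra.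
  exists ((alpha + b) / 2); split; [lra|lra|].
  suff : ((alpha + b) / 2) ^+ 2 * (2 - lambda) < lambda by lra.
  by rewrite -[ltRHS]bE ltr_pM2r// ltr_pXn2r ?nnegrE//; lra.
have a_gt0 : 0 < a by lra.
have sigma0 : 0 < lambda / a by rewrite divr_gt0.
have r1 : reachable P O f delta 1.
  exists f => // x Ox; have [p Pp pf] := Pf x Ox.
  by exists p; split; rewrite ?mul1r.
have asigma : 2 * a < lambda / a * (1 + a ^+ 2).
  by rewrite mulrAC ltr_pdivlMr// -mulrA -expr2.
have rs := reachable_iter a0 Ppara oO cf cd d0 normE a_gt a1 sigma0 asigma r1.
have [h ch hP] := reachable_hull Ppara oO cf cd d0 a_gt sigma0 rs.
exists h => // x Ox; have [hf [p Pp ph] _] := hP x Ox; split=> //.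
by exists p => //; rewrite [a * _]mulrC divfK ?gt_eqF// in ph.
Qed.

Lemma exprn_small (R : realType) (lambda c e : R) : 0 <= lambda < 1 -> 0 < e ->
  exists n, lambda ^+ n * c < e.
Proof.
move=> /andP[l0 l1] e0; have : lambda ^+ n * c @[n --> \oo] --> 0 * c.
  by apply: cvgMl; apply: cvg_expr; rewrite ger0_norm.
rewrite mul0r => /cvgrPdist_lt/(_ _ e0)[n _ /(_ n (leqnn n))].
rewrite /= sub0r normrN => h; exists n; exact: le_lt_trans (ler_norm _) h.
Qed.

Lemma geometric_cauchy (R : realType) (H : completeNormedModType R)
    (u : nat -> H) (lambda c : R) : 0 <= lambda < 1 ->
  (forall n, `|u n.+1 - u n| <= lambda ^+ n * ((1 - lambda) * c)) ->
  exists l, forall n, `|l - u n| <= lambda ^+ n * c.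
Proof.
move=> l01 uS; have /andP[l0 l1] := l01.
have c0 : 0 <= c.
  by have := le_trans (normr_ge0 _) (uS 0%N); rewrite expr0 mul1r pmulr_rge0// subr_gt0.
have uD n k : `|u (k + n)%N - u n| + lambda ^+ (k + n) * c <= lambda ^+ n * c.
  elim: k => [|k IH]; first by rewrite subrr normr0 add0r.
  apply: le_trans IH; rewrite addSn.
  have := ler_distD (u (k + n)%N) (u (k + n).+1) (u n); have := uS (k + n)%N.
  by rewrite exprS; lra.
have uB n m : (n <= m)%N -> `|u m - u n| <= lambda ^+ n * c.
  move=> /subnK <-; apply: le_trans (uD n (m - n)%N).
  by rewrite lerDl mulr_ge0// exprn_ge0.
have /cauchy_cvgP/cvg_ex[l ul] : cauchy (u n @[n --> \oo]).
  apply: cauchy_exP => e e0; have [n ne] := exprn_small c l01 e0.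
  exists (u n), n => // m /= nm; rewrite -ball_normE /= distrC.
  exact: le_lt_trans (uB _ _ nm) ne.
exists l => n; apply/ler_addgt0Pr => e e0.
move/cvgrPdist_lt: ul => /(_ _ e0)[m _ /(_ (maxn m n) (leq_maxl _ _))] /= lm.
have := uB n _ (leq_maxr m n); have := ler_distD (u (maxn m n)) l (u n); lra.
Qed.

Lemma approximate_projection (R : realType) (H : completeNormedModType R)
    (inner : {dot H for idfun}) (normE : forall x : H, `|x| ^+ 2 = inner x x)
    (P : set H) (alpha K : R) :
  0 <= alpha -> alpha < 1 -> paraconvex alpha P ->
  (1 + alpha ^+ 2) / (1 - alpha ^+ 2) < K ->
  exists2 T : H -> H, retraction P T & forall x, `|T x - x| <= K * dist x P.
Proof.
move=> a0 a1 Ppara; set K0 := _ / _ => K0K; have [P0 cP _] := Ppara.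
have a21 : alpha ^+ 2 < 1 by rewrite expr_lt1.
have a2 := sqr_ge0 alpha.
have K0E : K0 * (1 - alpha ^+ 2) = 1 + alpha ^+ 2.
  by rewrite divfK// gt_eqF// subr_gt0.
have K01 : 1 <= K0 by nra.
have [lambda [l0 l1 al lK]] : exists lambda, [/\ 0 <= lambda, lambda < 1,
    2 * alpha ^+ 2 < lambda * (1 + alpha ^+ 2) & 1 < (1 - lambda) * K].
  have KK : 0 < K + K0 by lra.
  exists (1 - 2 / (K + K0)); have mE : 2 / (K + K0) * (K + K0) = 2.
    by rewrite divfK// gt_eqF.
  move: (2 / (K + K0)) mE => m mE.
  have m0 : 0 < m by nra.
  have mK0 : m * K0 < 1 by nra.
  split; [nra|lra| |nra].
  suff : m * (1 + alpha ^+ 2) < 1 - alpha ^+ 2 by lra.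
  by rewrite -K0E; nra.
pose O := ~` P; have oO : open O by rewrite openC.
have cdist := dist_continuous P0.
pose delta n x := lambda ^+ n * ((1 - lambda) * (K * dist x P)).
pose good n (f : H -> H) := (forall x, O x -> {for x, continuous f}) /\
  forall x, O x -> exists2 p, P p & `|p - f x| < delta n x.

have dO x : O x -> 0 < dist x P by move=> Ox; apply: dist_gt0.
have K_gt0 : 0 < K by lra.
have c0 x : O x -> 0 < (1 - lambda) * (K * dist x P).
  by move=> Ox; rewrite !mulr_gt0 ?dO// subr_gt0.
have lambda_gt0 : 0 < lambda by nra.
have step (nf : nat * (H -> H)) : exists h : H -> H, good nf.1 nf.2 ->
    good nf.1.+1 h /\ forall x, O x -> `|h x - nf.2 x| <= delta nf.1 x.
  case: nf => n f; have [[cf fP]|?] := pselect (good n f); last by exists id.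
  have cd x : O x -> {for x, continuous (delta n)}.
    by move=> _; do 3! apply: cvgMr; apply: cdist.
  have d0 x : O x -> 0 < delta n x by move=> /c0 ?; rewrite mulr_gt0// exprn_gt0.
  have [h ch hP] := approximation_step normE a0 Ppara oO l1 al cf cd d0 fP.
  exists h => _ /=; split=> [|x /hP[/ltW//]]; split=> // x /hP[_ [p Pp ph]].
  by exists p => //; rewrite /delta exprS -mulrA.
have [next nextP] := choice step.
pose fix u n : H -> H := if n is m.+1 then next (m, u m) else id.
have u_good n : good n (u n).
  elim: n => [|n IH]; last by case: (nextP (n, u n) IH).
  split=> x Ox; first exact: cvg_id.
  have : dist x P < delta 0%N x.
    by rewrite /delta expr0 mul1r mulrA -[ltLHS]mul1r ltr_pM2r ?dO.
  by move=> /(dist_lt P0)[p Pp xp]; exists p => //; rewrite distrC.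
have uS n x : O x -> `|u n.+1 x - u n x| <= delta n x.
  by case: (nextP (n, u n) (u_good n)) => _; apply.
have /choice[T TP] (x : H) : exists y, (P x -> y = x) /\
    (O x -> forall n, `|y - u n x| <= lambda ^+ n * (K * dist x P)).
  have [Px|Ox] := pselect (P x); first by exists x.
  have [||l lP] := @geometric_cauchy _ _ (u^~ x) lambda (K * dist x P).
  - by rewrite l0.
  - by move=> n; apply: uS.
  by exists l.
have TK x : `|T x - x| <= K * dist x P.
  have [Px|Ox] := pselect (P x).
    by rewrite (TP x).1// subrr normr0 mulr_ge0 ?(ltW K_gt0)// dist_ge.
  by have := (TP x).2 Ox 0%N; rewrite expr0 mul1r.
have l01 : 0 <= lambda < 1 by rewrite l0.
exists T => //; split.
- move=> x; apply/cvgrPdist_lt => e e0; have [Px|Ox] := pselect (P x).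
    have e1 : 0 < e / (1 + K) by rewrite divr_gt0//; lra.
    near=> y; have : `|x - y| < e / (1 + K).
      by near: y; apply: cvgr_dist_lt.
    rewrite ltr_pdivlMr; last by lra.
    have := dist_le y Px; have := TK y; have := ler_distD y x (T y).
    by rewrite (TP x).1// (distrC y (T y)) (distrC y x); nra.
  have e3 : 0 < e / 3 by rewrite divr_gt0.
  have [n nx] := exprn_small (K * (dist x P + 1)) l01 e3.
  have cu' : u n y @[y --> x] --> u n x := (u_good n).1 x Ox.
  have cd' : dist y P @[y --> x] --> dist x P := cdist x.
  near=> y; have Oy : O y by near: y; apply: open_nbhs_nbhs.
  have uxy : `|u n x - u n y| < e / 3.
    by near: y; move/cvgrPdist_lt: cu'; apply.
  have : `|dist x P - dist y P| < 1 by near: y; move/cvgrPdist_lt: cd'; apply.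
  rewrite ltr_norml => /andP[dy _].
  have T3 z : O z -> dist z P <= dist x P + 1 -> `|T z - u n z| < e / 3.
    move=> Oz dz; apply: le_lt_trans nx; apply: le_trans ((TP z).2 Oz n) _.
    by rewrite ler_wpM2l ?exprn_ge0// ler_pM2l.
  have := T3 x Ox; have := T3 y Oy; have := ler_distD (u n x) (T x) (T y).
  have := ler_distD (u n y) (u n x) (T y); rewrite (distrC (u n y) (T y)).
  lra.
- move=> _ [x _ <-]; apply: contrapT => nPT.
  have Ox : O x by move=> Px; apply: nPT; rewrite (TP x).1.
  have [n] := exprn_small (K * dist x P + (1 - lambda) * (K * dist x P)) l01
    (dist_gt0 P0 cP nPT).
  apply/negP; rewrite -leNgt mulrDr.
  have [p Pp] := (u_good n).2 x Ox; rewrite /delta => pu.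
  have := dist_le (T x) Pp; have := (TP x).2 Ox n.
  by have := ler_distD (u n x) (T x) p; rewrite (distrC (u n x) p); lra.
- by move=> x /(TP x).1.
Unshelve. all: by end_near. Qed.

Theorem corollary3p5 (R : realType) (H : completeNormedModType R)
    (inner : {dot H for idfun})
    (normE : forall x : H, `|x| ^+ 2 = inner x x)
    (alpha : R) (alpha_ge0 : 0 <= alpha) (alpha_lt1 : alpha < 1)
    (P : set H) (P_bounded : bounded_set P) (P_paraconvex : paraconvex alpha P) :
  paraconvex (alpha * (1 + alpha ^+ 2) / (1 - alpha ^+ 2)) (Retr P).
Proof.

have [P0 cP Pa] := P_paraconvex.
have a21 : alpha ^+ 2 < 1 by rewrite expr_lt1.
pose K := (1 + alpha ^+ 2) / (1 - alpha ^+ 2).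
have K_ge0 : 0 <= K by apply: divr_ge0; have := sqr_ge0 alpha; lra.
have proj e : 0 < e -> exists2 T : H -> H, retraction P T &
    forall x, `|T x - x| <= (K + e) * dist x P.
  rewrite -(ltrDl K).
  exact: (approximate_projection normE alpha_ge0 alpha_lt1 P_paraconvex (K := K + e)).
have Retr0 : Retr P !=set0.
  have [T /(retraction_Retr P_bounded)[F RF _] _] := proj _ ltr01.
  by exists F.
have Cb_dist (f g : Cb H H) x : `|f x - g x| <= `|f - g|.
  exact: (Cb_le_norm (f - g) x).
split=> //.
- move=> F clF.
  have near_F e : 0 < e -> exists2 G, Retr P G & forall x, `|F x - G x| < e.
    move=> e0; have [G [RG FG]] := clF _ (nbhsx_ballx F e e0).
    exists G => // x; apply: le_lt_trans (Cb_dist _ _ _) _.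
    by rewrite -ball_normE in FG.
  split.
  + by have /bcontP[] := Cb_prop F.
  + move=> _ [x _ <-]; apply: contrapT => nP.
    have [G [_ GP _]] := near_F _ (dist_gt0 P0 cP nP).
    by move=> /(_ x); apply/negP; rewrite -leNgt dist_le//; apply: GP; exists x.
  + move=> a Pa'; apply/eqP; rewrite -subr_eq0 -normr_le0 leNgt; apply/negP => Fa.
    by have [G [_ _ GP] /(_ a)] := near_F _ Fa; rewrite GP// ltxx.
- move=> r r0 c q hq.
  have q_hull x : conv_hull (P `&` ball (c x) r) (q x).
    move: q hq; apply: conv_hull_sub => [f g t t01 hf hg|f [[_ fP _] cf]].
      exact: conv_hull_convex.
    move=> C [_]; apply; split; first by apply: fP; exists x.
    by rewrite -ball_normE /= (le_lt_trans (Cb_dist c f x))//; rewrite -ball_normE in cf.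
  have qa a : P a -> q a = a.
    move=> Pa'; move: q hq {q_hull}; apply: conv_hull_sub => [f g t _ hf hg|f [[_ _ fP] _]].
      change (t *: f a + (1 - t) *: g a = a).
      by rewrite hf hg -scalerDl addrC subrK scale1r.
    exact: fP.
  have q_near x : dist (q x) P <= alpha * r by apply: Pa (q_hull x).
  apply/ler_addgt0Pr => e e0.
  have ar : 0 <= alpha * r by rewrite mulr_ge0// ltW.
  have e1 : 0 < e / (alpha * r + 1) by rewrite divr_gt0//; lra.
  have [T [cT TP Ta] Tnear] := proj _ e1.
  have qc : continuous q by have /bcontP[] := Cb_prop q.
  have [|F RF FE] := @retraction_Retr _ _ P (T \o q) P_bounded.
    split=> [x|_ [x _ <-]|a Pa']; last by rewrite /= qa// Ta.
      by apply: continuous_comp; [exact: qc|exact: cT].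
    by apply: TP; exists (q x).
  apply: le_trans (dist_le q RF) _.
  have e1r : e / (alpha * r + 1) * (alpha * r) <= e.
    by rewrite mulrAC ler_pdivrMr; nra.
  have -> : alpha * (1 + alpha ^+ 2) / (1 - alpha ^+ 2) * r = K * (alpha * r).
    by rewrite /K; ring.
  apply: Cb_norm_le => [|x]; first by apply: addr_ge0 (mulr_ge0 _ ar) (ltW e0).
  rewrite -[X in `|X|]/(q x - F x) FE /= distrC; apply: le_trans (Tnear _) _.
  have := q_near x; have : 0 < K + e / (alpha * r + 1) by lra.
  nra.
Qed.
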